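(* Let $m$ be a positive integer. If $C$ is a ternary near-extremal self-dual code of length $12m$, then $A_{3i}(C) \equiv 0 \pmod 8$ for every $i = m, m+1, \ldots, 4m$, where $A_{j}(C)$ denotes the number of codewords of weight $j$ in $C$.
   Context: A ternary code of length $n$ is a linear subspace of $\mathbb{F}_3^n$. Its dual is $C^\perp=\{x\in\mathbb{F}_3^n : \sum_{k=1}^n x_k y_k = 0 \text{ for all } y\in C\}$, and $C$ is self-dual if $C=C^\perp$. The weight of a vector is the number of its nonzero coordinates, and the minimum weight of $C$ is the smallest weight of a nonzero codeword. A ternary self-dual code of length $n$ is called near-extremal if its minimum weight equals $3\lfloor n/12\rfloor$; thus for length $12m$ the minimum weight is $3m$. *)

(* Defs.v *)
From HB Require Import structures.
From mathcomp Require Import all_boot all_order all_algebra.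
Set Implicit Arguments. Unset Strict Implicit. Unset Printing Implicit Defensive.
Import GRing.Theory.
Local Open Scope ring_scope.

Notation word n := 'rV['F_3]_n.

Notation tcode n := {vspace word n}.

Definition dotw n (x y : word n) : 'F_3 := \sum_(k < n) x 0 k * y 0 k.

Definition wt n (x : word n) : nat := #|[set k : 'I_n | x 0 k != 0]|.

Definition self_dual n (C : tcode n) : Prop :=
  forall x : word n, (x \in C) <-> (forall y : word n, y \in C -> dotw x y = 0).

Definition min_weight n (C : tcode n) (d : nat) : Prop :=
  (exists2 x : word n, (x \in C) && (x != 0) & wt x = d) /\
  (forall x : word n, x \in C -> x != 0 -> (d <= wt x)%N).

Definition near_extremal n (C : tcode n) : Prop :=
  self_dual C /\ min_weight C (3 * (n %/ 12)).

Definition A_w n (C : tcode n) (j : nat) : nat :=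
  #|[set x : word n | (x \in C) && (wt x == j)]|.

(* Main.v *)
(** The words meeting coordinate [i] in weight [3 * j] are counted by a polynomial
    [V_i] in [Y = y^3].  By the MacWilliams identity with one coordinate singled
    out, [V_i - V_k] is, up to an explicit factor, a relative invariant; it
    vanishes to order [m] at [Y = 0] by near-extremality, hence to order [3m - 1]
    at [Y = 1], and also at [Y = - 1/8], while its degree is at most [4m - 1].  So
    [V_i = V_k]: the words of each weight form a 1-design, and double counting
    gives [12m * b = 3m * A_(3m)], where [b] is even because of [c <-> - c].
    Hence [8] divides [A_(3m)].

    For the other weights, an invariant of degree [12m] whose coefficients vanish
    up to [Y^m] is zero, again by orders at [0] and [1].  Subtracting multiples of
    Gleason's [(x^4 + 8xy^3)^(3(m-j)) * (y^3(x^3-y^3)^3)^j], whose [j]-th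
    coefficient is the first nonzero one and equals [1], propagates divisibility
    by [8] from the coefficients up to [Y^m] to all of them; this is applied to
    the weight enumerator minus [(x^4 + 8xy^3)^(3m)]. *)

Require Import Defs.
From mathcomp Require Import all_boot all_order all_algebra all_field.
From mathcomp Require Import ring zify.
Set Implicit Arguments. Unset Strict Implicit. Unset Printing Implicit Defensive.
Import GRing.Theory Num.Theory.
Local Open Scope ring_scope.

(** * Characters of F_3 and the MacWilliams identities *)

Lemma F3_cases (P : 'F_3 -> Prop) : P 0 -> P 1 -> P (1 + 1) -> forall a, P a.
Proof.
move=> P0 P1 P2 [[|[|[|//]]] lta].
- by have -> : Ordinal lta = 0 by exact: val_inj.
- by have -> : Ordinal lta = 1 by exact: val_inj.
- by have -> : Ordinal lta = 1 + 1 by exact: val_inj.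
Qed.

Lemma sum_F3 (V : nmodType) (F : 'F_3 -> V) :
  \sum_b F b = F 0 + F 1 + F (1 + 1).
Proof.
rewrite 3!big_ord_recl big_ord0 addr0 addrA.
by congr (F _ + F _ + F _); apply: val_inj.
Qed.

Lemma dotwC n (x y : word n) : dotw x y = dotw y x.
Proof. by apply: eq_bigr => k _; rewrite mulrC. Qed.

Lemma dotwDl n (x y z : word n) : dotw (x + y) z = dotw x z + dotw y z.
Proof. by rewrite -big_split; apply: eq_bigr => k _; rewrite mxE mulrDl. Qed.

Section MacWilliams.
Variables (K : numFieldType) (w : K).
Hypothesis w_root : w ^+ 2 + w + 1 = 0.

(** The exponent is the representative of [a] in {0, 1, 2}; as [w] is a primitive cube root of
    unity, this is a nontrivial additive character of F_3. *)
Definition chi (a : 'F_3) : K := w ^+ a.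

Let w2 : w * w = - w - 1.
Proof. by rewrite -[LHS]addr0 -[in LHS]oppr0 -w_root; ring. Qed.

Lemma cube_root1 : w ^+ 3 = 1.
Proof. by rewrite !exprS expr0 mulr1 w2 mulrBr mulrN w2; ring. Qed.

Lemma chi0 : chi 0 = 1.
Proof. by []. Qed.

Lemma chi1 : chi 1 = w.
Proof. by []. Qed.

Lemma chiD a b : chi (a + b) = chi a * chi b.
Proof. by rewrite /chi -exprD /= expr_mod // cube_root1. Qed.

Lemma chi_neq1 a : a != 0 -> chi a != 1.
Proof.
have w1 : w != 1.
  apply: contra_eq_neq w_root => ->.
  by rewrite expr1n (_ : 1 + 1 + 1 = 3%:R) ?pnatr_eq0 //; ring.
elim/F3_cases: a => //; rewrite chiD chi1 => _.
apply: contra_neq w1 => ww.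
by rewrite -[RHS]cube_root1 !exprS expr0 mulr1 ww mulr1.
Qed.

(** Fourier transform of a function on F_3 that is constant on nonzero elements. With [p = 1] and
    [q = y] it produces the factors [1 + 2 * y] and [1 - y] of the MacWilliams substitution. *)
Lemma chi_sum (p q : K) (a : 'F_3) :
  \sum_b chi (a * b) * (if b != 0 then q else p) =
  if a != 0 then p - q else p + 2 * q.
Proof.
rewrite sum_F3 /=; elim/F3_cases: a => /=;
  rewrite ?(mul0r, mulr0, mul1r, mulr1, mulrDl, mulrDr) /= ?(chiD, chi1); ring: w2.
Qed.

Variables (n : nat) (C : tcode n).
Hypothesis Csd : self_dual C.

Lemma sum_chi_code (v : word n) :
  \sum_(c in C) chi (dotw c v) = if v \in C then #|C|%:R else 0.
Proof.
case: ifPn => [/Csd Cv | Cv].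
  rewrite (eq_bigr (fun=> 1)) ?sumr_const // => c cC.
  by rewrite dotwC Cv.
have [/'forall_implyP Cv'|] := boolP [forall y, (y \in C) ==> (dotw v y == 0)].
  by case/negP: Cv; apply/Csd => y /Cv'/eqP.
case/forallPn => c0; rewrite negb_imply => /andP[c0C vc0].
(* Translating the sum by [c0] multiplies it by [chi (dotw v c0)], which is not 1. *)
set S := \sum_(c in C) _.
have SE : S = chi (dotw v c0) * S.
  rewrite {1}/S (reindex_inj (addrI c0)) mulr_sumr.
  apply: eq_big => [c|c _]; first by rewrite rpredDl.
  by rewrite dotwDl chiD dotwC.
apply/eqP; have := chi_neq1 vc0; apply: contraNT => S0.
by rewrite -(inj_eq (mulIf S0)) mul1r -SE.
Qed.

Lemma chi_big (x y : word n) : chi (dotw x y) = \prod_k chi (x 0 k * y 0 k).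
Proof. exact: (big_morph _ chiD chi0). Qed.

Lemma prod_sum_words (F : 'I_n -> 'F_3 -> K) :
  \prod_k \sum_b F k b = \sum_(v : word n) \prod_k F k (v 0 k).
Proof.
rewrite bigA_distr_bigA (reindex (fun v : word n => [ffun k => v 0 k])) /=.
  by apply: eq_bigr => v _; apply: eq_bigr => k _; rewrite ffunE.
exists (fun f : {ffun 'I_n -> 'F_3} => \row_k f k) => [v _|f _].
  by apply/rowP => k; rewrite !mxE ffunE.
by apply/ffunP => k; rewrite ffunE mxE.
Qed.

(** Expanding the product gives a sum over all words [v], weighted by the sum over [c] of
    [chi (dotw c v)]. That weight is [#|C|] on the dual code and 0 off it, and the dual is [C]
    itself. *)
Lemma poisson (phi : 'I_n -> 'F_3 -> K) :
  \sum_(c in C) \prod_k \sum_b chi (c 0 k * b) * phi k b =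
  #|C|%:R * \sum_(c in C) \prod_k phi k (c 0 k).
Proof.
under eq_bigr => c _.
  rewrite prod_sum_words.
  under eq_bigr => v _ do rewrite big_split /= -chi_big.
  over.
rewrite exchange_big mulr_sumr [RHS]big_mkcond; apply: eq_bigr => v _.
by rewrite -mulr_suml sum_chi_code; case: ifP => _; rewrite ?mul0r.
Qed.

Lemma prod_wt (x : word n) (p q : K) : p != 0 ->
  \prod_k (if x 0 k != 0 then q else p) = p ^+ n * (q / p) ^+ wt x.
Proof.
move=> p0; transitivity (\prod_k (p * (if x 0 k != 0 then q / p else 1))).
  by apply: eq_bigr => k _; case: ifP => _; rewrite ?mulr1 // mulrC divfK.
rewrite big_split prodr_const card_ord -big_mkcond /=; congr (_ * _).
by rewrite /wt -prodr_const; apply: eq_bigl => k; rewrite inE.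
Qed.

Lemma prod_wt1 (x : word n) (q : K) :
  \prod_k (if x 0 k != 0 then q else 1) = q ^+ wt x.
Proof. by rewrite prod_wt ?oner_eq0 // expr1n mul1r divr1. Qed.

Lemma wt_eq0 (x : word n) : (wt x == 0)%N = (x == 0).
Proof.
rewrite cards_eq0; apply/eqP/eqP => [/setP x0 | ->]; last first.
  by apply/setP => k; rewrite !inE mxE eqxx.
by apply/rowP => k; have := x0 k; rewrite !inE mxE => /negbFE/eqP.
Qed.

Lemma card_self_dual : (#|C| ^ 2 = 3 ^ n)%N.
Proof.
apply/eqP; rewrite -(eqr_nat K) !natrX.
(* The constant function 1, written so that [chi_sum] applies; its transform is [3 ^ n] at the zero
   word and 0 elsewhere. *)
have := poisson (fun _ b => if b != 0 then 1 else 1).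
under eq_bigr => c _.
  under eq_bigr => k _ do rewrite chi_sum subrr.
  rewrite prod_wt ?mul0r ?expr0n ?wt_eq0; last first.
    by rewrite mulr1 (_ : 1 + 2 = 3%:R) ?pnatr_eq0 //; ring.
  over.
under [X in _ = _ * X]eq_bigr => c _ do
  rewrite prod_wt ?oner_eq0 // divr1 !expr1n mulr1.
rewrite sumr_const -expr2 => <-.
rewrite (bigD1 0) ?mem0v //= eqxx mulr1 big1 => [|c /andP[_ /negbTE->]].
  by rewrite addr0 !mulr1 (_ : 1 + 2 = 3 :> K) //; ring.
by rewrite mulr0.
Qed.

Definition wenum (P : pred (word n)) (y : K) := \sum_(c in C | P c) y ^+ wt c.

Lemma macwilliams (y : K) : 1 + 2 * y != 0 ->
  #|C|%:R * wenum predT y =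
  (1 + 2 * y) ^+ n * wenum predT ((1 - y) / (1 + 2 * y)).
Proof.
move=> s0; rewrite /wenum !(eq_bigl _ _ (fun c => andbT (c \in C))).
rewrite -(eq_bigr _ (fun c _ => prod_wt1 c y)).
rewrite -(poisson (fun _ b => if b != 0 then y else 1)) mulr_sumr.
apply: eq_bigr => c _; under eq_bigr do rewrite chi_sum.
by rewrite prod_wt.
Qed.

(** Poisson summation with a factor at [i] that vanishes on 0. The term in [wenum predT t] does not
    depend on [i], so it cancels when two coordinates are compared. *)
Lemma macwilliams_coord (i : 'I_n) (y : K) : 1 + 2 * y != 0 -> 1 - y != 0 ->
  let t := (1 - y) / (1 + 2 * y) in let V := wenum (fun c => c 0 i != 0) in
  #|C|%:R * V y = (1 + 2 * y) ^+ n *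
    (2 * y / (1 + 2 * y) * wenum predT t
     - 3 * y / ((1 + 2 * y) * (1 - y)) * V t).
Proof.
move=> s0 s1 t V.
(* Ratio of the transform of the special factor at [i] ([2 * y] at 0, [- y] elsewhere) to that of
   the ordinary factor ([1 + 2 * y] and [1 - y]). *)
pose lam (a : 'F_3) : K := (if a != 0 then - y / (1 - y) else 2 * y / (1 + 2 * y)).
pose phi k (b : 'F_3) : K := if b != 0 then y else (k != i)%:R.
have phiE (c : word n) : \prod_k phi k (c 0 k) = (c 0 i != 0)%:R * y ^+ wt c.
  rewrite (bigD1 i) //= /phi eqxx; case: ifP => [ci|_]; last by rewrite !mul0r.
  rewrite mul1r -prod_wt1 [RHS](bigD1 i) //= ci; congr (_ * _).
  by apply: eq_bigr => k ->.
have hatE (c : word n) : \prod_k (\sum_b chi (c 0 k * b) * phi k b) =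
    (1 + 2 * y) ^+ n * (lam (c 0 i) * t ^+ wt c).
  under eq_bigr => k _ do rewrite chi_sum.
  rewrite mulrCA -prod_wt // [in RHS](bigD1 i) //= mulrA (bigD1 i) //= eqxx.
  congr (_ * _); last by apply: eq_bigr => k ->.
  by rewrite /lam /= mulr0n; case: ifP => _; rewrite ?divfK //; ring.
have := poisson phi.
rewrite (eq_bigr _ (fun c _ => phiE c)) (eq_bigr _ (fun c _ => hatE c)).
have -> (z : K) : \sum_(c in C) (c 0 i != 0)%:R * z ^+ wt c = V z.
  rewrite /V /wenum [RHS]big_mkcondr; apply: eq_bigr => c _.
  by case: ifP; rewrite ?mul1r ?mul0r.
move=> <-; rewrite -mulr_sumr; congr (_ * _).
rewrite /V /wenum (eq_bigl _ _ (fun c => andbT (c \in C))) big_mkcondr /=.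
rewrite !mulr_sumr -sumrB; apply: eq_bigr => c _; rewrite /lam.
case: ifP => _; last by rewrite mulr0 subr0.
by field; rewrite s0 s1.
Qed.

End MacWilliams.

(** * Orders of vanishing at 0 and 1 *)

Section Polys.
Variable K : numFieldType.
Implicit Types f q G : {poly K}.

(** The substitution [Y = y^3] preserves the order at 1, because 1 is a simple root of [y^3 - 1]:
    the cofactor [y^2 + y + 1] takes the value 3 there. *)
Lemma dvdp_comp_cube f e :
  ('X - 1%:P) ^+ e %| f \Po 'X^3 -> ('X - 1%:P) ^+ e %| f.
Proof.
have [->|f0] := eqVneq f 0; first by rewrite dvdp0.
have [j [q]] := multiplicity_XsubC f 1.
rewrite f0 /= => q1 ->.
have cube : ('X - 1%:P) \Po 'X^3 = ('X ^+ 2 + 'X + 1) * ('X - 1%:P) :> {poly K}.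
  by rewrite comp_polyB comp_polyX comp_polyC polyC1; ring.
rewrite comp_polyM (rmorphXn (comp_poly _)) /= cube exprMn mulrA.
have [le_ej _|lt_je] := leqP e j; first by rewrite dvdp_mull // dvdp_exp2l.
rewrite -(subnK (ltnW lt_je)) exprD dvdp_mul2r ?expf_neq0 ?polyXsubC_eq0 //.
move/(dvdp_trans (dvdp_exp (_ : 0 < e - j)%N (dvdpp _))).
rewrite subn_gt0 => /(_ lt_je); rewrite dvdp_XsubCl /root !hornerE.
rewrite horner_comp !hornerE expr1n mulf_eq0 expf_eq0.
rewrite (negbTE (q1 : q.[1] != 0)) /= expr1n (_ : 1 + 1 + 1 = 3%:R) ?pnatr_eq0; last by ring.
by rewrite andbF.
Qed.

Lemma dvdp_split f a b : 'X^a %| f -> ('X - 1%:P) ^+ b %| f ->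
  exists2 q, f = q * ('X^a * ('X - 1%:P) ^+ b) & (size q <= size f - (a + b))%N.
Proof.
move=> fa fb; have /dvdpP[q fE] : 'X^a * ('X - 1%:P) ^+ b %| f.
  rewrite Gauss_dvdp ?fa //; apply: coprimep_expl; apply: coprimep_expr.
  by rewrite coprimep_XsubC rootX oner_eq0.
exists q => //; have [->|q0] := eqVneq q 0; first by rewrite size_poly0.
rewrite fE size_Mmonic ?rpredM ?rpredX ?monicX ?monicXsubC //.
rewrite size_Mmonic ?monicXn ?monic_exp ?monicXsubC ?expf_neq0 ?polyX_eq0 //.
by rewrite size_polyXn size_exp_XsubC addSn !addnS /= addnK.
Qed.

(** Integers above 1 avoid the zeros of [1 + 2 * y] and [1 - y], so identities with these
    denominators can be checked there. *)
Lemma poly_eq_at_nats f q : (forall k, (1 < k)%N -> f.[k%:R] = q.[k%:R]) -> f = q.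
Proof.
move=> E; apply/eqP; rewrite -subr_eq0; apply/eqP.
apply: (@roots_geq_poly_eq0 _ _ [seq k%:R | k <- iota 2 (size (f - q))]).
- apply/allP => x /mapP[k]; rewrite mem_iota => /andP[k1 _] ->.
  by rewrite /root !hornerE E // subrr.
- by rewrite map_inj_uniq ?iota_uniq // => x y /eqP; rewrite eqr_nat => /eqP.
- by rewrite size_map size_iota.
Qed.

Lemma homogenize f N : (size f <= N.+1)%N -> exists G, forall y : K, 1 + 2 * y != 0 ->
  (1 + 2 * y) ^+ (3 * N) * f.[((1 - y) / (1 + 2 * y)) ^+ 3] = G.[y].
Proof.
move=> sf.
exists (\sum_(j < N.+1) f`_j *: ((1 - 'X) ^+ (3 * j) * (1 + 2%:R *: 'X) ^+ (3 * (N - j)))).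
move=> y s0; rewrite (horner_coef_wide _ sf) mulr_sumr horner_sum.
apply: eq_bigr => j _; rewrite !hornerE /= -exprM.
have -> : (3 * N = 3 * (N - j) + 3 * j)%N by have := ltn_ord j; lia.
rewrite exprD expr_div_n; have : (1 + 2 * y) ^+ (3 * j) != 0 by rewrite expf_neq0.
by move: ((1 + 2 * y) ^+ (3 * j)) (_ ^+ (3 * (N - j))) => B A B0; field.
Qed.

(** The substitution sends [y = 1] to 0, so order [a] at [Y = 0] is traded for order [3 * a] at
    [y = 1]. *)
Lemma homogenize_XnM f a N : (size f <= N.+1)%N -> exists G, forall y : K, 1 + 2 * y != 0 ->
  (1 + 2 * y) ^+ (3 * (a + N)) * ('X^a * f).[((1 - y) / (1 + 2 * y)) ^+ 3] =
  (1 - y) ^+ (3 * a) * G.[y].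
Proof.
move=> /homogenize[G GE]; exists G => y s0; rewrite -GE // hornerM hornerXn -exprM expr_div_n.
rewrite mulnDr exprD; have : (1 + 2 * y) ^+ (3 * a) != 0 by rewrite expf_neq0.
by move: ((1 + 2 * y) ^+ (3 * a)) (_ ^+ (3 * N)) => B A B0; field.
Qed.

Lemma factor_Xn f a : (forall j, (j < a)%N -> f`_j = 0) -> exists q, f = 'X^a * q.
Proof.
move=> fa; exists (drop_poly a f); rewrite mulrC -[LHS](poly_take_drop a).
suff -> : take_poly a f = 0 by rewrite add0r.
by apply/polyP => j; rewrite coef_take_poly coef0; case: ifP => // /fa.
Qed.

End Polys.

(** * Weights in self-dual codes *)

(* The enumerator in [Y = y^3]; the division is exact for self-dual codes. *)
Definition enum_poly (R : nzRingType) n (C : tcode n) (P : pred (word n)) : {poly R} :=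
  \sum_(c in C | P c) 'X^(wt c %/ 3).

(** Every nonzero element of F_3 has square 1. *)
Lemma wt_nat n (x : word n) : (wt x)%:R = dotw x x.
Proof.
rewrite /wt cardsE -sum1_card natr_sum big_mkcond; apply: eq_bigr => k _.
rewrite -topredE /=; move: (x 0 k); apply: F3_cases; exact: val_inj.
Qed.

Section SelfDual.
Variables (n : nat) (C : tcode n).
Hypothesis Csd : self_dual C.

Lemma wt_dvd3 c : c \in C -> (3 %| wt c)%N.
Proof.
move=> cC; rewrite (dvdn_pcharf (pchar_Fp (isT : prime 3))) wt_nat.
by rewrite (Csd c).1.
Qed.

Lemma coef_enum_poly (R : nzRingType) (P : pred (word n)) j :
  (enum_poly R C P)`_j = #|[set c | [&& c \in C, P c & wt c == (3 * j)%N]]|%:R.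
Proof.
rewrite /enum_poly coef_sum cardsE -sum1_card natr_sum big_mkcond [RHS]big_mkcond.
apply: eq_bigr => c _; rewrite coefXn -topredE /=.
case: ifP => [/andP[cC ->]|]; last first.
  by rewrite andbA => ->.
have := wt_dvd3 cC; rewrite cC /= => /dvdnP[l ->].
by rewrite mulnK // mulnC eqn_pmul2l // eq_sym; case: eqP.
Qed.

Lemma horner_enum_poly (K : numFieldType) (P : pred (word n)) (y : K) :
  (enum_poly K C P).[y ^+ 3] = wenum C P y.
Proof.
rewrite /enum_poly horner_sum; apply: eq_bigr => c /andP[cC _].
by rewrite hornerXn -exprM mulnC divnK ?wt_dvd3.
Qed.

Lemma map_enum_poly (P : pred (word n)) :
  map_poly intr (enum_poly int C P) = enum_poly algC C P.
Proof. by rewrite rmorph_sum; apply: eq_bigr => c _; rewrite /= map_polyXn. Qed.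

Definition coordwt (i : 'I_n) j := #|[set c | [&& c \in C, c 0 i != 0 & wt c == j]]|.

Lemma sum_coordwt j : (\sum_i coordwt i j = j * A_w C j)%N.
Proof.
under eq_bigr do rewrite /coordwt -sum1_card big_mkcond.
rewrite exchange_big /= /A_w -sum1_card big_distrr /= [RHS]big_mkcond.
apply: eq_bigr => c _; rewrite inE muln1.
case: ifP => [/andP[cC /eqP <-]|H].
  rewrite [RHS]/wt -sum1_card [RHS]big_mkcond; apply: eq_bigr => i _.
  by rewrite !inE cC eqxx andbT.
rewrite big1 // => i _; rewrite !inE andbCA H andbF //.
Qed.

Lemma coordwt_even i j : (2 %| coordwt i j)%N.
Proof.
pose S (a : 'F_3) := [set c : word n | [&& c \in C, c 0 i == a & wt c == j]].
have wtN (c : word n) : wt (- c) = wt c.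
  by apply: eq_card => k; rewrite !inE mxE oppr_eq0.
have SN : S (- 1) = [set - c | c in S 1].
  apply/setP => c; rewrite -[c]opprK (mem_imset _ _ oppr_inj) !inE.
  by rewrite rpredN wtN mxE eqr_opp.
have S1N : S 1 :&: S (- 1) = set0.
  by apply/setP => c; rewrite !inE; elim/F3_cases: (c 0 i); rewrite /= ?andbF.
have -> : coordwt i j = (#|S 1%R| + #|S (- 1)%R|)%N.
  rewrite -cardsUI S1N cards0 addn0; apply: eq_card => c; rewrite !inE.
  by elim/F3_cases: (c 0 i); rewrite /= ?andbF ?orbF.
by rewrite SN card_imset ?addnn ?dvdn2 ?odd_double //; exact: oppr_inj.
Qed.

Lemma wt_le (c : word n) : (wt c <= n)%N.
Proof. by rewrite -[leqRHS]card_ord max_card. Qed.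

Lemma wt_full (c : word n) i : wt c = n -> c 0 i != 0.
Proof.
move=> wc; have /setP/(_ i) : [set k | c 0 k != 0] = setT.
  by apply/eqP; rewrite eqEcard subsetT cardsT card_ord -/(wt c) wc leqnn.
by rewrite !inE.
Qed.

End SelfDual.

Definition omega : algC := (- 1 + sqrtC (- 3)) / 2.

Lemma omega_root : omega ^+ 2 + omega + 1 = 0.
Proof.
have s3 : sqrtC (- 3) ^+ 2 = - 3 :> algC by rewrite sqrtCK.
by rewrite /omega; field: s3.
Qed.

(** * The 1-design property *)

Section NearExtremal.
Variables (m : nat) (C : tcode (12 * m)).
Hypotheses (m_gt0 : (0 < m)%N) (Cne : near_extremal C).

Let Csd : self_dual C := Cne.1.

Lemma card_code : #|C| = (3 ^ (6 * m))%N.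
Proof.
apply/eqP; rewrite -(eqn_exp2r _ _ (isT : 0 < 2)%N) (card_self_dual omega_root Csd).
by rewrite -expnM mulnAC.
Qed.

Lemma near_extremal_wt c : c \in C -> (wt c < 3 * m)%N -> c = 0.
Proof.
move=> cC; rewrite ltnNge; apply: contraNeq => c0.
by have := Cne.2.2 c cC c0; rewrite mulKn.
Qed.

Lemma A_w0 : A_w C 0 = 1%N.
Proof.
rewrite /A_w (_ : [set _ | _] = [set 0]) ?cards1 //; apply/setP => c.
by rewrite !inE wt_eq0 andb_idl // => /eqP->; exact: mem0v.
Qed.

Lemma A_w_small j : (0 < j < 3 * m)%N -> A_w C j = 0%N.
Proof.
move=> /andP[j0 jm]; apply/eqP; rewrite cards_eq0; apply/eqP/setP => c.
rewrite !inE; apply/andP => -[cC /eqP wc].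
move: (near_extremal_wt cC); rewrite wc => /(_ jm) c0.
by move/eqP: c0; rewrite -wt_eq0 wc; case: j j0 {jm wc}.
Qed.

Lemma near_extremal_1design i k j : coordwt C i j = coordwt C k j.
Proof.
have [/dvdnP[l]|ndvd] := boolP (3 %| j)%N; last first.
  rewrite /coordwt !eq_card0 // => c; rewrite !inE; apply/and3P => -[cC _ /eqP wc];
    by rewrite -wc (wt_dvd3 Csd cC) in ndvd.
rewrite mulnC => ->; pose V i := enum_poly algC C (fun c => c 0 i != 0).
have coefV a : (V a)`_l = (coordwt C a (3 * l))%:R by exact: coef_enum_poly.
suff VE : V i = V k by apply/eqP; rewrite -(eqr_nat algC) -!coefV VE.
apply/eqP; rewrite -subr_eq0; set d := V i - V k.
have dlow j' : (j' < m)%N -> d`_j' = 0.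
  move=> jm; rewrite coefB !(coef_enum_poly Csd) !eq_card0 ?subrr // => c;
  rewrite !inE; apply/and3P => -[cC ci /eqP wc];
  by move: ci; rewrite (near_extremal_wt cC) ?mxE ?eqxx // wc ltn_pmul2l.
(* Words of weight [12 * m] meet both [i] and [k], so the terms of degree [4 * m] cancel. *)
have dsize : (size d <= 4 * m)%N.
  apply/leq_sizeP => j' jm; rewrite coefB !(coef_enum_poly Csd) /=.
  apply/eqP; rewrite subr_eq0 eqr_nat; apply/eqP; apply: eq_card => c; rewrite !inE.
  have [wc|_] := eqVneq (wt c) (3 * j')%N; last by rewrite !andbF.
  by rewrite !(@wt_full _ c) //; have := wt_le c; lia.
have [d1 dE] := factor_Xn dlow.
have d1size : (size d1 <= (3 * m).-1.+1)%N.
  have [->|d10] := eqVneq d1 0; first by rewrite size_poly0.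
  move: dsize; rewrite dE mulrC size_Mmonic ?monicXn // size_polyXn addnS /=.
  by rewrite prednK ?muln_gt0 // -(leq_add2r m (size d1)) -mulSnr.
have [G GE] := homogenize_XnM m d1size.
(* One less than [3 * m], since [macwilliams_coord] has [1 - y] in a denominator. *)
pose e := (3 * m).-1.
have dcomp : #|C|%:R *: (d \Po 'X^3) =
    ('X - 1%:P) ^+ e * ((- 1) ^+ e *: (- 3%:R *: 'X * (1 + 2%:R *: 'X) ^+ 2 * G)).
  apply: poly_eq_at_nats => y y1.
  have s0 : 1 + 2 * y%:R != 0 :> algC by rewrite -natrM nat1r pnatr_eq0.
  have s1 : 1 - y%:R != 0 :> algC by rewrite subr_eq0 eq_sym pnatr_eq1; lia.
  have dV z : d.[z ^+ 3] = wenum C (fun c => c 0 i != 0) z - wenum C (fun c => c 0 k != 0) z.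
    by rewrite hornerD hornerN !(horner_enum_poly Csd).
  set yy := y%:R in s0 s1 *; set t := (1 - yy) / (1 + 2 * yy).
  have FE : #|C|%:R * d.[yy ^+ 3] =
      - 3 * yy / ((1 + 2 * yy) * (1 - yy)) * ((1 + 2 * yy) ^+ (12 * m) * d.[t ^+ 3]).
    rewrite !dV mulrBr !(macwilliams_coord omega_root Csd _ s0 s1) -/t.
    by ring.
  rewrite hornerZ horner_comp hornerXn FE dE.
  (* As [d] has degree at most [4 * m - 1], three factors [1 + 2 * y] are left over; the denominator
     consumes one, which leaves the square in [dcomp]. *)
  have -> : (12 * m = 3 + 3 * (m + (3 * m).-1))%N by lia.
  rewrite exprD -[_ * _ * _.[_]]mulrA GE //.
  have -> : (3 * m = e.+1)%N by rewrite /e; lia.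
  have -> : (1 - yy) ^+ e.+1 = (1 - yy) * ((- 1) ^+ e * (yy - 1) ^+ e).
    by rewrite -exprMn mulN1r opprB exprS.
  rewrite !(hornerM, horner_exp, hornerZ, hornerD, hornerN, hornerC, hornerX).
  by field; rewrite s0 s1.
have C0 : #|C|%:R != 0 :> algC by rewrite card_code pnatr_eq0 expn_eq0.
have [q dq qsize] : exists2 q, d = q * ('X^m * ('X - 1%:P) ^+ e) & (size q <= size d - (m + e))%N.
  apply: dvdp_split; first by rewrite dE dvdp_mulr.
  by apply: dvdp_comp_cube; rewrite -(dvdpZr _ _ C0) dcomp dvdp_mulr.
(* The orders [m] and [3 * m - 1] already exhaust the degree, so one further root forces [q = 0]. *)
have /size1_polyC qC : (size q <= 1)%N by apply: leq_trans qsize _; rewrite /e; lia.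
(* The root [y = - 1/2] of [1 + 2 * y]. The substitution has a pole there, but [dcomp] is an
   identity of polynomials and may be evaluated. *)
have root8 : d.[(- 2^-1) ^+ 3] = 0.
  apply: (mulfI C0); rewrite mulr0; have := congr1 (horner^~ (- 2^-1)) dcomp.
  rewrite hornerZ horner_comp hornerXn => ->.
  rewrite !(hornerM, horner_exp, hornerZ, hornerD, hornerN, hornerC, hornerX).
  by field.
move/eqP: root8; rewrite dq qC.
rewrite !(hornerM, horner_exp, hornerZ, hornerD, hornerN, hornerC, hornerX).
rewrite !mulf_eq0 !expf_eq0 /= oppr_eq0 invr_eq0 pnatr_eq0 andbF /=.
case/orP => [/eqP-> | /andP[_]]; first by rewrite polyC0 eqxx.
have -> : (- 2^-1) ^+ 3 - 1 = - (9 / 8) :> algC by field.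
by rewrite oppr_eq0 mulf_eq0 invr_eq0 !pnatr_eq0.
Qed.

Lemma A_min_mod8 : (8 %| A_w C (3 * m))%N.
Proof.
have i0 : 'I_(12 * m) by apply: (@Ordinal _ 0); rewrite muln_gt0.
have := sum_coordwt C (3 * m).
rewrite (eq_bigr (fun=> coordwt C i0 (3 * m))); last first.
  by move=> k _; exact: near_extremal_1design.
rewrite sum_nat_const card_ord; have /dvdnP[b ->] := coordwt_even C i0 (3 * m).
(* Here [12m * 2b = 3m * A], whence [A = 8b]. *)
move=> E; apply/dvdnP; exists b; apply/eqP.
by rewrite -(eqn_pmul2l (_ : 0 < 3 * m)%N) ?muln_gt0 // -E; lia.
Qed.

End NearExtremal.

(** * Divisibility by 8 *)

(* Invariance of [x^(12m) * f(y^3/x^3)] under [(x, y) |-> (x + 2y, x - y) / sqrt 3], at [x = 1]. *)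
Definition macwilliams_inv m (f : {poly algC}) := forall y : algC, 1 + 2 * y != 0 ->
  (1 + 2 * y) ^+ (12 * m) * f.[((1 - y) / (1 + 2 * y)) ^+ 3] =
  3 ^+ (6 * m) * f.[y ^+ 3].

Lemma macwilliams_inv_sub m f g (a : algC) : macwilliams_inv m f -> macwilliams_inv m g ->
  macwilliams_inv m (f - a *: g).
Proof.
by move=> fi gi y s0; rewrite !hornerD !hornerN !hornerZ !mulrBr fi // mulrCA gi // mulrCA.
Qed.

(** Order [m + 1] at [Y = 0] yields, by invariance, order [3 * (m + 1)] at [Y = 1]; the total
    [4 * m + 4] exceeds the degree. *)
Lemma macwilliams_inv_eq0 m f : (0 < m)%N -> macwilliams_inv m f ->
  (size f <= (4 * m).+1)%N -> (forall j, (j <= m)%N -> f`_j = 0) -> f = 0.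
Proof.
move=> m0 fi sf /(factor_Xn (a := m.+1))[f1 fE].
have sf1 : (size f1 <= (3 * m).-1.+1)%N.
  have [->|f10] := eqVneq f1 0; first by rewrite size_poly0.
  move: sf; rewrite fE mulrC size_Mmonic ?monicXn // size_polyXn addnS /= addnS ltnS.
  by rewrite prednK ?muln_gt0 // -(leq_add2r m (size f1)) -mulSnr.
have [G GE] := homogenize_XnM m.+1 sf1.
have fcomp : 3 ^+ (6 * m) *: (f \Po 'X^3) =
    ('X - 1%:P) ^+ (3 * m.+1) * ((- 1) ^+ (3 * m.+1) *: G).
  apply: poly_eq_at_nats => y y1.
  have s0 : 1 + 2 * y%:R != 0 :> algC by rewrite -natrM nat1r pnatr_eq0.
  rewrite hornerZ horner_comp hornerXn -fi // fE.
  have -> : (12 * m = 3 * (m.+1 + (3 * m).-1))%N by lia.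
  rewrite GE // !(hornerM, horner_exp, hornerZ, hornerD, hornerN, hornerC, hornerX).
  by rewrite mulrCA mulrA -exprMn mulN1r opprB.
have [q fq] : exists2 q, f = q * ('X^(m.+1) * ('X - 1%:P) ^+ (3 * m.+1)) &
    (size q <= size f - (m.+1 + 3 * m.+1))%N.
  apply: dvdp_split; first by rewrite fE dvdp_mulr.
  apply: dvdp_comp_cube; rewrite -(dvdpZr _ _ (_ : 3 ^+ (6 * m) != 0 :> algC)).
    by rewrite fcomp dvdp_mulr.
  by rewrite expf_neq0 // pnatr_eq0.
have -> : (size f - (m.+1 + 3 * m.+1) = 0)%N by move: sf; lia.
by rewrite leqn0 size_poly_eq0 fq => /eqP->; rewrite mul0r.
Qed.

(* [(x^4 + 8xy^3)^(3(m-j)) * (y^3(x^3-y^3)^3)^j] at [x = 1], [Y = y^3]. *)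
Definition gleason (R : comNzRingType) m j : {poly R} :=
  'X^j * ((1 + 8%:R *: 'X) ^+ (3 * (m - j)) * (1 - 'X) ^+ (3 * j)).

Lemma gleason_inv m j : (j <= m)%N -> macwilliams_inv m (gleason algC m j).
Proof.
move=> jm y s0; rewrite !(hornerM, horner_exp, hornerZ, hornerD, hornerN, hornerC, hornerX).
set t := (1 - y) / _.
(* Each of the two generators, of degrees 4 and 12, is itself invariant, up to the power of [sqrt 3]
   given by its degree. *)
have E4 : (1 + 2 * y) ^+ 4 * (1 + 8 * t ^+ 3) = 3 ^+ 2 * (1 + 8 * y ^+ 3).
  by rewrite /t; field.
have E12 : (1 + 2 * y) ^+ 12 * (t ^+ 3 * (1 - t ^+ 3) ^+ 3) = 3 ^+ 6 * (y ^+ 3 * (1 - y ^+ 3) ^+ 3).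
  by rewrite /t; field.
have rearr (s u k z : algC) a b :
    s ^+ (4 * a) * s ^+ (12 * b) * (u ^+ b * (k ^+ a * z ^+ (3 * b))) =
    (s ^+ 4 * k) ^+ a * (s ^+ 12 * (u * z ^+ 3)) ^+ b.
  by rewrite (exprMn a (s ^+ 4)) (exprMn b (s ^+ 12)) (exprMn b u) -!exprM; ring.
have -> : (12 * m = 4 * (3 * (m - j)) + 12 * j)%N by lia.
rewrite exprD rearr E4 E12.
rewrite !(exprMn _ (3 ^+ _)) (exprMn _ (y ^+ 3)) -!exprM.
have -> : (6 * m = 2 * (3 * (m - j)) + 6 * j)%N by lia.
by rewrite exprD; ring.
Qed.

Lemma size_gleason (R : comNzRingType) m j : (j <= m)%N -> (size (gleason R m j) <= (4 * m).+1)%N.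
Proof.
move=> jm; rewrite /gleason.
have sX (p : {poly R}) k : (size p <= 2)%N -> (size (p ^+ k) <= k.+1)%N.
  move=> p2; apply: leq_trans (size_poly_exp_leq _ _) _.
  by case: (size p) p2 => [|[|[|]]] //= _; rewrite ?mul0n ?mul1n.
have s1 : (size (1 + 8%:R *: 'X : {poly R})%R <= 2)%N.
  rewrite (leq_trans (size_polyD _ _)) // geq_max size_poly1 /=.
  by rewrite (leq_trans (size_scale_leq _ _)) // size_polyX.
have s2 : (size (1 - 'X : {poly R})%R <= 2)%N.
  by rewrite (leq_trans (size_polyD _ _)) // geq_max size_poly1 size_polyN size_polyX.
have sM (p q : {poly R}) a b : (size p <= a.+1 -> size q <= b.+1 -> size (p * q)%R <= (a + b).+1)%N.
  move=> pa qb; apply: leq_trans (size_polyMleq _ _) _.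
  by have := leq_add pa qb; rewrite addnS addSn; case: (size p + size q)%N.
have : (j + (3 * (m - j) + 3 * j) <= 4 * m)%N by lia.
by rewrite -ltnS; apply: leq_trans; apply/sM/sM; rewrite ?size_polyXn ?sX.
Qed.

(** The family is unitriangular, so coefficients can be eliminated over the integers without
    division. *)
Lemma coef_gleason (R : comNzRingType) m j i : (i <= j)%N -> (gleason R m j)`_i = (i == j)%:R.
Proof.
move=> ij; rewrite coefXnM ltn_neqAle ij andbT; case: eqVneq => [->|//] /=.
rewrite subnn -horner_coef0.
rewrite !(hornerM, horner_exp, hornerZ, hornerD, hornerN, hornerC, hornerX).
by rewrite mulr0 addr0 subr0 !expr1n mulr1.
Qed.

Lemma map_gleason m j : map_poly intr (gleason int m j) = gleason algC m j.
Proof.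
rewrite /gleason !(rmorphM, rmorphXn, rmorphD, rmorphN, rmorph1) /= map_polyZ map_polyX.
by rewrite rmorph_nat.
Qed.

Lemma gleason0_mod8 m i : (0 < i)%N -> (8 %| (gleason int m 0)`_i)%Z.
Proof.
rewrite /gleason expr0 mul1r muln0 expr0 mulr1 subn0.
suff [q ->] : exists q, (1 + 8%:R *: 'X : {poly int}) ^+ (3 * m) = 1 + 8%:R *: q.
  by rewrite coefD coef1 coefZ; case: i => // i _; rewrite add0r dvdz_mulr.
elim: (3 * m)%N => [|k [q IH]]; first by exists 0; rewrite scaler0 addr0 expr0.
exists ('X + q * (1 + 8%:R *: 'X)); rewrite exprS IH -!mul_polyC; ring.
Qed.

Lemma macwilliams_inv_dvd m (d : int) (f : {poly int}) : (0 < m)%N ->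
  macwilliams_inv m (map_poly intr f) -> (size f <= (4 * m).+1)%N ->
  (forall i, (i <= m)%N -> (d %| f`_i)%Z) -> forall i, (d %| f`_i)%Z.
Proof.
move=> m0 finv sf flow.
(* [k] counts the coefficients up to degree [m] not yet known to vanish. They are cleared from the
   lowest up; at [k = 0] the polynomial is zero. *)
suff: forall k g, (k <= m.+1)%N -> macwilliams_inv m (map_poly intr g) ->
    (size g <= (4 * m).+1)%N -> (forall i, (i <= m)%N -> (d %| g`_i)%Z) ->
    (forall i, (i < m.+1 - k)%N -> g`_i = 0) -> forall i, (d %| g`_i)%Z.
  by move=> /(_ m.+1 f (leqnn _) finv sf flow); apply => i; rewrite subnn.
elim=> [|k IH] g km ginv sg glow gz i.
  have sgC : (size (map_poly (intr : int -> algC) g) <= (4 * m).+1)%N.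
    exact: leq_trans (size_poly _ _) sg.
  have g0 : map_poly (intr : int -> algC) g = 0.
    by apply: (macwilliams_inv_eq0 m0 ginv) => // l lm; rewrite coef_map /= gz ?subn0 ?ltnS.
  have /eqP := congr1 (fun p : {poly algC} => p`_i) g0.
  by rewrite coef_map coef0 /= intr_eq0 => /eqP->; rewrite dvdz0.
have jm : (m - k <= m)%N by exact: leq_subr.
set j := (m - k)%N in jm; pose g' := g - g`_j *: gleason int m j.
have gE : g = g' + g`_j *: gleason int m j by rewrite subrK.
have dj : (d %| g`_j)%Z by exact: glow.
rewrite gE coefD coefZ rpredD ?dvdz_mulr //; apply: IH => [| | |i' im|i' im].
- exact: ltnW.
- rewrite /g' rmorphB /= map_polyZ map_gleason.
  by apply: macwilliams_inv_sub => //; exact: gleason_inv.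
- rewrite (leq_trans (size_polyD _ _)) // geq_max sg size_polyN.
  by rewrite (leq_trans (size_scale_leq _ _)) // size_gleason.
- by rewrite coefB coefZ rpredB ?dvdz_mulr // glow.
- have ij : (i' <= j)%N by rewrite /j; lia.
  rewrite coefB coefZ coef_gleason //; case: eqVneq => [->|ne].
    by rewrite mulr1 subrr.
  by rewrite mulr0 subr0 gz // subSS -/j ltn_neqAle ne.
Qed.

Section NearExtremal.
Variables (m : nat) (C : tcode (12 * m)).
Hypotheses (m_gt0 : (0 < m)%N) (Cne : near_extremal C).

Let Csd : self_dual C := Cne.1.
Let W := enum_poly int C predT.

Lemma coefW j : W`_j = (A_w C (3 * j))%:Z.
Proof. by rewrite coef_enum_poly // natz. Qed.

Lemma W_inv : macwilliams_inv m (map_poly intr W).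
Proof.
move=> y s0; rewrite map_enum_poly !(horner_enum_poly Csd).
by rewrite -(macwilliams omega_root Csd s0) card_code // natrX.
Qed.

Lemma sizeW : (size W <= (4 * m).+1)%N.
Proof.
apply/leq_sizeP => j jm; rewrite coefW /A_w eq_card0 // => c; rewrite !inE.
by apply/andP => -[_ /eqP wc]; have := wt_le c; rewrite wc; lia.
Qed.

Lemma A_w_mod8 i : (0 < i)%N -> (8 %| A_w C (3 * i))%N.
Proof.
(* The constant coefficient of [W] is 1. Subtracting [gleason int m 0], which is 1 modulo 8, removes
   it and keeps the other coefficients modulo 8. *)
move=> i0; have W'inv : macwilliams_inv m (map_poly intr (W - gleason int m 0)).
  rewrite rmorphB /= map_gleason -[gleason _ _ _]scale1r.
  exact: macwilliams_inv_sub W_inv (gleason_inv (leq0n m)).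
have W'size : (size (W - gleason int m 0)%R <= (4 * m).+1)%N.
  by rewrite (leq_trans (size_polyD _ _)) // geq_max sizeW size_polyN size_gleason.
have W'dvd j : (j <= m)%N -> (8 %| (W - gleason int m 0)`_j)%Z.
  rewrite coefB coefW; case: j => [|j] jm.
    by rewrite muln0 A_w0 // coef_gleason.
  rewrite rpredB ?gleason0_mod8 //; move: jm; rewrite leq_eqVlt => /orP[/eqP-> | jm].
    exact: (A_min_mod8 m_gt0 Cne).
  by rewrite A_w_small // muln_gt0 ltn_pmul2l.
have := macwilliams_inv_dvd m_gt0 W'inv W'size W'dvd i.
by rewrite coefB rpredBr ?gleason0_mod8 // coefW.
Qed.

End NearExtremal.

Local Close Scope ring_scope.

Theorem theorem3p2 (m : nat) (C : tcode (12 * m)) :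
  (0 < m)%N -> near_extremal C ->
  forall i : nat, (m <= i <= 4 * m)%N -> A_w C (3 * i) %% 8 = 0%N.
Proof.
move=> m_gt0 Cne i /andP[le_mi _]; apply/eqP.
exact: A_w_mod8 m_gt0 Cne _ (leq_trans m_gt0 le_mi).
Qed.
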